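(* Let $Q=(q_{ij}:i,j\in\mathbb Z_+)$ be a single birth $Q$-matrix and let $c=(c_i)_{i\ge 0}$ and $f=(f_i)_{i\ge 0}$ be real-valued functions on $\mathbb Z_+$. Let $\Omega g=Qg+cg$ and let $\widetilde F_n^{(i)}$ be the sequences defined from $Q$ and $c$ as in the context. Then every solution $g=(g_n)_{n\ge 0}$ (real-valued) of the Poisson equation $\Omega g=f$ on $\mathbb Z_+$ has the representation $$g_n=g_0+\sum_{0\le k\le n-1}\ \sum_{0\le j\le k}\frac{\widetilde F_k^{(j)}\,(f_j-c_jg_0)}{q_{j,j+1}},\qquad n\ge 0. \qquad ( * )$$ In particular, every harmonic function $g$ of $\Omega$ (i.e. $\Omega g=0$) can be represented as $$g_n=g_0\Bigg(1-\sum_{0\le k\le n-1}\ \sum_{0\le j\le k}\frac{\widetilde F_k^{(j)}c_j}{q_{j,j+1}}\Bigg),\qquad n\ge 0.$$ Conversely, for each initial value $g_0\in\mathbb R$, the function $(g_n)_{n\ge0}$ defined by $( * )$ is a solution of $\Omega g=f$.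
   Context: A single birth $Q$-matrix on $\mathbb Z_+=\{0,1,2,\dots\}$ is a real matrix $Q=(q_{ij})$ with $q_{ij}\ge 0$ for $i\neq j$, which is conservative ($\sum_j q_{ij}=0$ for every $i$), irreducible, and satisfies $q_{i,i+1}>0$ and $q_{i,i+j}=0$ for all $i\in\mathbb Z_+$ and $j\ge 2$. For a function $g$ on $\mathbb Z_+$, $(Qg)_i=\sum_j q_{ij}(g_j-g_i)$ and $(\Omega g)_i=(Qg)_i+c_ig_i$. Define $\tilde q_n^{(k)}=\sum_{j=0}^k q_{nj}-c_n$ for $0\le k<n$, and $$\widetilde F_i^{(i)}=1,\qquad \widetilde F_n^{(i)}=\frac1{q_{n,n+1}}\sum_{k=i}^{n-1}\tilde q_n^{(k)}\widetilde F_k^{(i)},\qquad n>i\ge 0.$$ Empty sums are $0$. *)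

(* Defs.v *)
From HB Require Import structures.
From mathcomp Require Import all_boot all_order all_algebra.
From mathcomp Require Import all_classical all_reals all_analysis.
Set Implicit Arguments.
Unset Strict Implicit.
Unset Printing Implicit Defensive.
Import Order.TTheory GRing.Theory Num.Theory.
Import numFieldNormedType.Exports.
Local Open Scope classical_set_scope.
Local Open Scope ring_scope.

(* Every state [j] can be reached from every state [i] through jumps of
   positive rate; the empty path covers [i = j]. *)
Definition irreducible_Q (R : realType) (q : nat -> nat -> R) : Prop :=
  forall i j : nat, exists s : seq nat,
    path (fun a b => (a != b) && (0 < q a b)) i s /\ last i s = j.

Record single_birth_Qmatrix (R : realType) (q : nat -> nat -> R) : Prop :=
  SingleBirthQmatrix {
    sb_offdiag_ge0 : forall i j : nat, i != j -> 0 <= q i j;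
    sb_conservative : forall i : nat, series (q i) @ \oo --> (0 : R);
    sb_irreducible : irreducible_Q q;
    sb_birth_gt0 : forall i : nat, 0 < q i i.+1;
    sb_single_birth : forall i j : nat, (2 <= j)%N -> q i (i + j)%N = 0
  }.

(* The sum over all of Z_+; it is a finite sum for a single birth Q-matrix,
   see [Qop_finite]. *)
Definition Qop (R : realType) (q : nat -> nat -> R) (g : nat -> R) (i : nat) : R :=
  limn (series (fun j => q i j * (g j - g i))).

Definition Omega (R : realType) (q : nat -> nat -> R) (c : nat -> R)
    (g : nat -> R) (i : nat) : R :=
  Qop q g i + c i * g i.

(* [qtilde q c n k] is $\tilde q_n^{(k)}$. *)
Definition qtilde (R : realType) (q : nat -> nat -> R) (c : nat -> R)
    (n k : nat) : R :=
  (\sum_(0 <= j < k.+1) q n j) - c n.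

(* The list $[F_i^{(i)}; F_{i+1}^{(i)}; ...; F_{i+m}^{(i)}]$ (tildes omitted). *)
Fixpoint Ftilde_seq (R : realType) (q : nat -> nat -> R) (c : nat -> R)
    (i m : nat) : seq R :=
  if m is m'.+1 then
    let s := Ftilde_seq q c i m' in
    rcons s ((q (i + m)%N (i + m).+1)^-1 *
             \sum_(0 <= l < m) qtilde q c (i + m) (i + l) * s`_l)
  else [:: 1].

(* [Ftilde q c i n] is $\widetilde F_n^{(i)}$, meaningful for [i <= n]; its
   defining equations are [Ftilde_diag] and [Ftilde_rec]. *)
Definition Ftilde (R : realType) (q : nat -> nat -> R) (c : nat -> R)
    (i n : nat) : R :=
  (Ftilde_seq q c i (n - i))`_(n - i).

Lemma size_Ftilde_seq (R : realType) (q : nat -> nat -> R) (c : nat -> R)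
  (i m : nat) : size (Ftilde_seq q c i m) = m.+1.
Proof. by elim: m => //= m IH; rewrite size_rcons IH. Qed.

Lemma nth_Ftilde_seq (R : realType) (q : nat -> nat -> R) (c : nat -> R)
  (i m l : nat) : (l <= m)%N -> (Ftilde_seq q c i m)`_l = (Ftilde_seq q c i l)`_l.
Proof.
elim: m => [|m IH]; first by rewrite leqn0 => /eqP ->.
rewrite leq_eqVlt => /predU1P [-> //|lm].
by rewrite /= nth_rcons size_Ftilde_seq lm IH.
Qed.

Lemma Ftilde_diag (R : realType) (q : nat -> nat -> R) (c : nat -> R) (i : nat) :
  Ftilde q c i i = 1.
Proof. by rewrite /Ftilde subnn. Qed.

Lemma Ftilde_rec (R : realType) (q : nat -> nat -> R) (c : nat -> R) (i n : nat) :
  (i < n)%N ->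
  Ftilde q c i n =
    (q n n.+1)^-1 * \sum_(i <= k < n) qtilde q c n k * Ftilde q c i k.
Proof.
move=> lt_in; rewrite {1}/Ftilde.
have -> : (n - i = (n - i.+1).+1)%N by rewrite subnSK.
rewrite /= nth_rcons size_Ftilde_seq ltnn eqxx subnSK // subnKC 1?ltnW//.
congr (_ * _).
rewrite [RHS](_ : _ = \sum_(0 + i <= k < n) qtilde q c n k * Ftilde q c i k) //.
rewrite big_addn.
apply: eq_big_nat => l /andP[_ l_lt].
rewrite /Ftilde addnK [(l + i)%N]addnC nth_Ftilde_seq //.
by rewrite -ltnS subnSK.
Qed.

Lemma Qop_finite (R : realType) (q : nat -> nat -> R) (g : nat -> R) (i : nat) :
  single_birth_Qmatrix q ->
  Qop q g i = \sum_(0 <= j < i.+2) q i j * (g j - g i).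
Proof.
move=> hq; apply: lim_near_cst => //; exists i.+2 => // n /= le_n.
rewrite /series /= (big_cat_nat _ le_n) //= [X in _ + X]big_nat_cond.
rewrite [X in _ + X]big1 ?addr0 // => j /andP[/andP[le_j _] _].
have -> : j = (i + (j - i))%N by rewrite subnKC // (leq_trans _ le_j) // ltnW.
by rewrite (sb_single_birth hq) ?mul0r // leq_subRL ?addn2 // (leq_trans _ le_j) // ltnW.
Qed.

(* Main.v *)
(* In terms of the increments [d k = g k.+1 - g k], summation by parts turns
   [Omega g i = f i] into the triangular recursion
     q_{i,i+1} d_i = sum_(k < i) qtilde_i^(k) d_k + (f_i - c_i g_0),
   which determines [d] from [g 0].  Its Green kernel is
   [Ftilde_i^(j) / q_{j,j+1}]: by the recursion defining [Ftilde], the sums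
   [sum_(j <= i) Ftilde_i^(j) (f_j - c_j g_0) / q_{j,j+1}] satisfy it too. *)
Require Import Defs.
From mathcomp Require Import all_boot all_order all_algebra.
From mathcomp Require Import all_classical all_reals all_analysis.
From mathcomp Require Import ring.
Set Implicit Arguments.
Unset Strict Implicit.
Import Order.TTheory GRing.Theory Num.Theory.
Local Open Scope ring_scope.

(** Abel summation; subtracting the end value [g n] leaves no boundary term. *)
Lemma sumr_by_parts (R : pzRingType) (a g : nat -> R) (n : nat) :
  \sum_(0 <= j < n) a j * (g j - g n) =
  - \sum_(0 <= k < n) (\sum_(0 <= j < k.+1) a j) * (g k.+1 - g k).
Proof.
elim: n => [|n IH]; first by rewrite !big_geq ?oppr0.
(* Moving the base point from [g n] to [g n.+1] costs one increment times the full partial sum. *)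
have -> : \sum_(0 <= j < n.+1) a j * (g j - g n.+1) =
    \sum_(0 <= j < n.+1) a j * (g j - g n) -
    (\sum_(0 <= j < n.+1) a j) * (g n.+1 - g n).
  rewrite mulr_suml -sumrB; apply: eq_bigr => j _.
  by rewrite -mulrBr opprB addrA subrK.
rewrite [X in X - _]big_nat_recr //= subrr mulr0 addr0 IH.
by rewrite [in RHS]big_nat_recr //= opprD.
Qed.

Lemma exchange_big_nat_triangle (V : nmodType) (G : nat -> nat -> V) (n : nat) :
  \sum_(0 <= j < n) \sum_(j <= k < n) G j k =
  \sum_(0 <= k < n) \sum_(0 <= j < k.+1) G j k.
Proof.
elim: n => [|n IH]; first by rewrite !big_geq.
rewrite [RHS]big_nat_recr //= -IH [LHS]big_nat_recr //= big_nat1.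
rewrite [in RHS]big_nat_recr //= addrA -big_split /=; congr (_ + _).
by apply: eq_big_nat => j /andP[_ lt_jn]; rewrite big_nat_recr // ltnW.
Qed.

(** In row [i] the term [j = i.+1] is the birth term, [j = i] vanishes, and the rest is summed by
    parts. *)
Lemma Omega_increments (R : realType) (q : nat -> nat -> R) (c g : nat -> R)
    (i : nat) : single_birth_Qmatrix q ->
  Omega q c g i = q i i.+1 * (g i.+1 - g i)
    - \sum_(0 <= k < i) qtilde q c i k * (g k.+1 - g k) + c i * g 0%N.
Proof.
move=> hq; rewrite /Omega Qop_finite // !big_nat_recr //= subrr mulr0 addr0.
rewrite sumr_by_parts /qtilde.
(* The [- c i] inside [qtilde] multiplies a telescoping sum [g i - g 0], which turns [c i * g 0]
   into [c i * g i]. *)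
under [in RHS]eq_bigr do rewrite mulrBl.
rewrite sumrB -mulr_sumr telescope_sumr //.
ring.
Qed.

Lemma Omega_eqP (R : realType) (q : nat -> nat -> R) (c g : nat -> R)
    (i : nat) (y : R) : single_birth_Qmatrix q ->
  Omega q c g i = y <->
  g i.+1 - g i = (q i i.+1)^-1 *
    (\sum_(0 <= k < i) qtilde q c i k * (g k.+1 - g k) + (y - c i * g 0%N)).
Proof.
move=> hq; rewrite Omega_increments //.
have q_neq0 : q i i.+1 != 0 by rewrite gt_eqF // (sb_birth_gt0 hq).
split=> [<-|->]; last by rewrite mulVKf //; ring.
by apply: (mulfI q_neq0); rewrite mulVKf //; ring.
Qed.

(** The summand [j = i] yields [h i]; for [j < i], expand the kernel by [Ftilde_rec] and exchange
    the sums over [j <= k < i]. *)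
Lemma Ftilde_sum_rec (R : realType) (q : nat -> nat -> R) (c h : nat -> R)
    (i : nat) :
  \sum_(0 <= j < i.+1) Ftilde q c j i * h j / q j j.+1 =
  (q i i.+1)^-1 *
    (\sum_(0 <= k < i) qtilde q c i k *
       (\sum_(0 <= j < k.+1) Ftilde q c j k * h j / q j j.+1) + h i).
Proof.
rewrite big_nat_recr //= Ftilde_diag mul1r mulrDr [h i / _]mulrC.
congr (_ + _).
under [in RHS]eq_bigr do rewrite mulr_sumr.
rewrite -exchange_big_nat_triangle mulr_sumr.
apply: eq_big_nat => j /andP[_ lt_ji].
rewrite Ftilde_rec // -!mulrA mulr_suml; congr (_ * _).
by apply: eq_bigr => k _; rewrite !mulrA.
Qed.

(** Both sides obey the same recursion, whose value at [n] depends only on earlier ones, so strong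
    induction applies. *)
Lemma Poisson_increments (R : realType) (q : nat -> nat -> R)
    (c f g : nat -> R) : single_birth_Qmatrix q ->
  (forall i, Omega q c g i = f i) -> forall n,
  g n.+1 - g n =
  \sum_(0 <= j < n.+1) Ftilde q c j n * (f j - c j * g 0%N) / q j j.+1.
Proof.
move=> hq Og; elim/ltn_ind => n IH.
rewrite (Ftilde_sum_rec q c (fun j => f j - c j * g 0%N)).
have /Omega_eqP -> // := Og n.
congr (_ * (_ + _)).
by apply: eq_big_nat => k /andP[_ lt_kn]; rewrite IH.
Qed.

Lemma Poisson_representation (R : realType) (q : nat -> nat -> R)
    (c f g : nat -> R) : single_birth_Qmatrix q ->
  (forall i, Omega q c g i = f i) -> forall n,
  g n = g 0%N + \sum_(0 <= k < n) \sum_(0 <= j < k.+1)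
                  Ftilde q c j k * (f j - c j * g 0%N) / q j j.+1.
Proof.
move=> hq Og n; under eq_bigr do rewrite -(Poisson_increments hq Og).
by rewrite telescope_sumr // addrC subrK.
Qed.

Theorem theorem1p1 (R : realType) (q : nat -> nat -> R) (c f : nat -> R)
    (hq : single_birth_Qmatrix q) :
  (forall g : nat -> R, (forall i : nat, Omega q c g i = f i) ->
     forall n : nat,
       g n = g 0%N + \sum_(0 <= k < n) \sum_(0 <= j < k.+1)
                       Ftilde q c j k * (f j - c j * g 0%N) / q j j.+1)
  /\
  (forall g : nat -> R, (forall i : nat, Omega q c g i = 0) ->
     forall n : nat,
       g n = g 0%N * (1 - \sum_(0 <= k < n) \sum_(0 <= j < k.+1)
                            Ftilde q c j k * c j / q j j.+1))
  /\
  (forall g0 : R, forall i : nat,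
     Omega q c
       (fun n : nat => g0 + \sum_(0 <= k < n) \sum_(0 <= j < k.+1)
                              Ftilde q c j k * (f j - c j * g0) / q j j.+1) i
     = f i).
Proof.
split; first by move=> g; apply: Poisson_representation.
split=> [g Og n | g0 i].
  (* Representation with zero right-hand side; [- g 0] factors out of every term. *)
  rewrite {1}(Poisson_representation hq Og) mulrBr mulr1.
  congr (_ + _); rewrite mulr_sumr -sumrN; apply: eq_bigr => k _.
  rewrite mulr_sumr -sumrN; apply: eq_bigr => j _.
  ring.
set g := fun n => g0 + _.
(* [Omega_eqP] involves [g 0], which is the prescribed [g0] since the outer sum is empty there. *)
have g_0 : g 0%N = g0 by rewrite /g big_geq // addr0.
have dg k : g k.+1 - g k =
    \sum_(0 <= j < k.+1) Ftilde q c j k * (f j - c j * g0) / q j j.+1.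
  by rewrite /g [in X in X - _]big_nat_recr //=; ring.
(* The row equation is now the kernel recursion with source [f j - c j * g0]. *)
apply/(Omega_eqP c g i (f i) hq); rewrite g_0 dg.
under [in RHS]eq_bigr do rewrite dg.
exact: (Ftilde_sum_rec q c (fun j => f j - c j * g0)).
Qed.
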